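(* Let $m>1$ and $\pi_1,\pi_2\in S_m$. For $n\ge m$, let $X_{\pi_1},X_{\pi_2}$ be the random variables on $S_n$ (uniform distribution) with $X_{\pi}(\tau)$ the number of occurrences of $\pi$ in $\tau$. Then, as $n\to\infty$, $$\mathrm{Cov}(X_{\pi_1},X_{\pi_2})=c(\pi_1,\pi_2)\, n^{2m-1}+O(n^{2m-2}),$$ where $$c(\pi_1,\pi_2)=\frac{1}{((2m-1)!)^2}\left(\mathrm{Tr}(A_mP_{\pi_1}A_mP_{\pi_2}^{-1})-\binom{2m-1}{m-1}^2\right),$$ and $$\mathrm{Tr}(A_mP_{\pi_1}A_mP_{\pi_2}^{-1})=\sum_{i,j=1}^{m}[i,j]_m\,[\pi_1(i),\pi_2(j)]_m.$$
   Context: An occurrence of $\pi\in S_m$ in $\tau\in S_n$ is a set of $m$ positions of $\tau$ such that the subsequence of $\tau$ at those positions is order-isomorphic to $\pi$. $P_\pi=[\delta(\pi(i),j)]_{m\times m}$ is the permutation matrix of $\pi$ ($\delta$ the Kronecker delta). For integers $1\le i,j\le m$, $[i,j]_m=\binom{i-1+j-1}{i-1}\binom{m-i+m-j}{m-i}$, and $A_m$ is the $m\times m$ matrix with $(A_m)_{ij}=[i,j]_m$. *)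

(* Defs.v *)
From mathcomp Require Import all_boot all_order all_algebra all_fingroup.

Set Implicit Arguments.
Unset Strict Implicit.
Unset Printing Implicit Defensive.

Import GRing.Theory.
Local Open Scope ring_scope.

(* [enum S] lists the positions of [S] in increasing order; positions and
   values of permutations are numbered from 0. *)
Definition subword (n : nat) (tau : 'S_n) (S : {set 'I_n}) : seq nat :=
  [seq val (tau i) | i <- enum S].

Definition word (m : nat) (pi : 'S_m) : seq nat :=
  [seq val (pi i) | i <- enum 'I_m].

Definition order_isomorphic (u v : seq nat) : bool :=
  (size u == size v) &&
  [forall i : 'I_(size u), forall j : 'I_(size u),
     (nth 0%N u i < nth 0%N u j)%N == (nth 0%N v i < nth 0%N v j)%N].

Definition occurrence (m n : nat) (pi : 'S_m) (tau : 'S_n) (S : {set 'I_n}) :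
    bool :=
  (#|S| == m) && order_isomorphic (subword tau S) (word pi).

Definition nb_occ (m n : nat) (pi : 'S_m) (tau : 'S_n) : nat :=
  #|[set S : {set 'I_n} | occurrence pi tau S]|.

Definition unif_expectation (R : numFieldType) (T : finType) (X : T -> R) : R :=
  (\sum_(t : T) X t) / #|T|%:R.

Definition unif_covariance (R : numFieldType) (T : finType) (X Y : T -> R) : R :=
  unif_expectation (fun t =>
    (X t - unif_expectation X) * (Y t - unif_expectation Y)).

(* Here [i] and [j] range over 1, ..., m. *)
Definition bracket (m i j : nat) : nat :=
  ('C((i - 1) + (j - 1), i - 1) * 'C((m - i) + (m - j), m - i))%N.

Definition bracket_mx (R : numFieldType) (m : nat) : 'M[R]_m :=
  \matrix_(i, j) (bracket m i.+1 j.+1)%:R.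

(* The entry (i, j) of [perm_mx pi] is 1 if [pi i = j] and 0 otherwise. *)
Definition pattern_trace (R : numFieldType) (m : nat) (pi1 pi2 : 'S_m) : R :=
  \tr (bracket_mx R m *m perm_mx pi1 *m bracket_mx R m *m invmx (perm_mx pi2)).

Definition cov_coef (R : numFieldType) (m : nat) (pi1 pi2 : 'S_m) : R :=
  1 / (2 * m - 1)`!%:R ^+ 2 *
  (pattern_trace R pi1 pi2 - 'C(2 * m - 1, m - 1)%:R ^+ 2).

(* Main.v *)
(* Expand the covariance as the sum, over pairs (S, T) of m-sets of positions,
   of P(pi1 occurs at S and pi2 at T) - 1/m!^2. If S and T are disjoint, the
   two events are independent and the term vanishes. The O(n^(2m-2)) pairs with
   at least two common positions contribute at most 1 each. If S and T share
   exactly one position, the i-th of S and the j-th of T, then an occurrence of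
   both patterns is determined by the pair of value sets (tau S, tau T) and the
   other values of tau; these value sets share one value, of rank pi1 i in tau S
   and pi2 j in tau T. So positions and values lead to the same count, namely
   the number C(n, 2m-1) [i, j]_m of pairs of m-sets meeting in one element of
   prescribed ranks, and the term is [pi1 i, pi2 j]_m / (2m-1)! - 1/m!^2. *)
Require Import Defs.
From mathcomp Require Import all_boot all_order all_algebra all_fingroup.
From mathcomp Require Import zify ring lra.

Set Implicit Arguments.
Unset Strict Implicit.
Unset Printing Implicit Defensive.

(** * Occurrences in terms of ranks *)

(* The rank of [x] in [S], counted from 0. *)
Definition pos n (S : {set 'I_n}) (x : 'I_n) : nat := #|[set y in S | y < x]|.

Lemma ltn_pos n (S : {set 'I_n}) (x : 'I_n) : x \in S -> pos S x < #|S|.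
Proof.
move=> xS; apply: proper_card; apply/properP; split.
  by apply/subsetP => y; rewrite inE => /andP[].
by exists x => //; rewrite inE ltnn andbF.
Qed.

Lemma leq_pos n (S : {set 'I_n}) (x y : 'I_n) : x <= y -> pos S x <= pos S y.
Proof.
move=> xy; apply: subset_leq_card; apply/subsetP => z; rewrite !inE.
by case/andP=> -> /= zx; apply: leq_trans zx xy.
Qed.

Lemma pos_mono n (S : {set 'I_n}) (x y : 'I_n) :
  x \in S -> (pos S x < pos S y) = (x < y).
Proof.
move=> xS; apply/idP/idP => [|xy].
  by apply: contraTT; rewrite -!leqNgt; apply: leq_pos.
apply: proper_card; apply/properP; split.
  by apply/subsetP => z; rewrite !inE => /andP[-> /= zx]; apply: ltn_trans zx xy.
by exists x; rewrite !inE ?ltnn ?andbF // xS.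
Qed.

Lemma pos_inj n (S : {set 'I_n}) : {in S &, injective (pos S)}.
Proof.
move=> x y xS yS e; apply: val_inj; apply/eqP; rewrite eqn_leq.
by rewrite leqNgt -(pos_mono _ yS) e ltnn leqNgt -(pos_mono _ xS) e ltnn.
Qed.

(** [enum S] filters the increasing list of all ordinals, and in a strictly increasing list exactly
    [k] entries lie below the one at index [k]. *)
Lemma pos_nth_enum n (S : {set 'I_n}) (x0 : 'I_n) k :
  k < #|S| -> pos S (nth x0 (enum S) k) = k.
Proof.
move=> kS; set s := map val (enum S).
have ss : sorted ltn s.
  rewrite /s {1}/enum_mem.
  have := iota_ltn_sorted 0 n; rewrite -val_enum_ord enumT => h.
  rewrite sorted_map; apply: sorted_filter; first by move=> ? ? ?; apply: ltn_trans.
  by rewrite -sorted_map.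
have sz : size s = #|S| by rewrite size_map -cardE.
have := @Order.POrderTheory.count_lt_nth _ nat 0 s k ss.
rewrite sz => /(_ kS); rewrite (nth_map x0) -?cardE //= => {2}<-.
rewrite /pos count_map cardE -size_filter /enum_mem -filter_predI.
congr size; apply: eq_filter => y; by rewrite !inE /= andbC.
Qed.

Lemma pos_surj n (S : {set 'I_n}) k :
  k < #|S| -> exists2 x, x \in S & pos S x = k.
Proof.
move=> kS; have /card_gt0P[x0 _] : 0 < #|S| by apply: leq_ltn_trans kS.
exists (nth x0 (enum S) k); last exact: pos_nth_enum.
by rewrite -mem_enum mem_nth // -cardE.
Qed.

Lemma index_enum_pos n (S : {set 'I_n}) x : x \in S -> index x (enum S) = pos S x.
Proof.
move=> xS; rewrite -{2}(nth_index x (s := enum S) (x := x)) ?mem_enum //.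
by rewrite pos_nth_enum // cardE index_mem mem_enum.
Qed.

(** Recovers a value of [pi] from comparisons alone, which is all that order isomorphism
    provides. *)
Lemma card_perm_lt m (pi : 'S_m) (i : 'I_m) : #|[set k | pi k < pi i]| = pi i.
Proof.
rewrite -(card_imset _ (@perm_inj _ pi)).
have -> : pi @: [set k | pi k < pi i] = [set k : 'I_m | k < pi i].
  apply/setP => k; rewrite inE; apply/imsetP/idP => [[l]|ki].
    by rewrite inE => + ->.
  by exists (perm_inv pi k); rewrite ?inE permKV.
have winj : injective (widen_ord (ltnW (ltn_ord (pi i)))).
  by move=> a b /(congr1 val) e; apply: val_inj.
rewrite -[RHS]card_ord -(card_imset _ winj).
congr #|pred_of_set _|; apply/setP => k; rewrite inE;
  apply/idP/imsetP => [ki|[l _ ->]] //=.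
by exists (Ordinal ki) => //; apply: val_inj.
Qed.

Lemma nth_word m (pi : 'S_m) (k : 'I_m) : nth 0 (word pi) k = pi k.
Proof. by rewrite (nth_map k) ?size_enum_ord // nth_ord_enum. Qed.

Lemma nth_subword n (tau : 'S_n) (S : {set 'I_n}) x :
  x \in S -> nth 0 (subword tau S) (pos S x) = tau x.
Proof.
move=> xS; rewrite (nth_map x) -?cardE ?ltn_pos //.
by rewrite -index_enum_pos // nth_index ?mem_enum.
Qed.

(** Comparisons become ranks: a rank counts the smaller values, so equal comparisons give equal
    ranks; conversely, [pos] preserves and reflects strict order. *)
Lemma occurrenceP m n (pi : 'S_m) (tau : 'S_n) (S : {set 'I_n}) :
  reflect (#|S| = m /\ forall x (i : 'I_m), x \in S -> pos S x = i ->
             pos (tau @: S) (tau x) = pi i)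
          (occurrence pi tau S).
Proof.
apply: (iffP andP) => [[/eqP Sm /andP[_ /forallP iso]]|[Sm posE]].
  split=> // x i xS xi.
  have szS : size (subword tau S) = m by rewrite size_map -cardE.
  have ordE (y : 'I_n) (j : 'I_m) : y \in S -> pos S y = j -> (tau y < tau x) = (pi j < pi i).
    move=> yS yj.
    have jS : j < size (subword tau S) by rewrite szS.
    have iS : i < size (subword tau S) by rewrite szS.
    have /forallP/(_ (Ordinal iS)) /eqP := iso (Ordinal jS).
    rewrite [nat_of_ord (Ordinal jS)]/= [nat_of_ord (Ordinal iS)]/= !nth_word.
    by rewrite -yj -xi !nth_subword.
  rewrite -card_perm_lt /pos.
  have -> : [set y in tau @: S | y < tau x] = tau @: [set y in S | tau y < tau x].
    apply/setP => z; rewrite inE; apply/andP/imsetP => [[/imsetP[y yS ->] h]|[y]].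
      by exists y; rewrite ?inE ?yS.
    by rewrite inE => /andP[yS h] ->; rewrite imset_f.
  rewrite card_imset; last exact: perm_inj.
  (* [f] is the increasing enumeration of [S]; it carries the indices [k] with [pi k < pi i] onto
     the positions in [S] whose value is below [tau x]. *)
  have [f fS fpos] : exists2 f : 'I_m -> 'I_n, forall k, f k \in S & forall k, pos S (f k) = k.
    have h (k : 'I_m) : {y | (y \in S) && (pos S y == k)}.
      apply/sigW; have [|y yS yk] := @pos_surj _ S k; first by rewrite Sm.
      by exists y; rewrite yS yk /=.
    exists (fun k => sval (h k)) => k; case: (h k) => y /= /andP[] //.
    by move=> _ /eqP.
  have finj : injective f by move=> a b e; apply: val_inj; rewrite /= -!fpos e.
  rewrite -(card_imset _ finj); congr #|pred_of_set _|; apply/setP => y.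
  rewrite inE; apply/andP/imsetP => [[yS h]|[k]].
    have yk : pos S y < m by rewrite -Sm ltn_pos.
    exists (Ordinal yk); first by rewrite inE -(ordE y).
    by apply: (@pos_inj _ S) => //; rewrite fpos.
  by rewrite inE => h ->; rewrite fS (ordE _ k).
split; first by rewrite Sm.
apply/andP; split;
  first by rewrite (size_map _ (enum S)) (size_map _ (enum _)) size_enum_ord -cardE Sm.
apply/forallP => i; apply/forallP => j; apply/eqP.
have szS : size (subword tau S) = m by rewrite size_map -cardE.
have im : i < m by apply: leq_trans (ltn_ord i) _; rewrite szS.
have jm : j < m by apply: leq_trans (ltn_ord j) _; rewrite szS.
have [x xS xi] : exists2 x, x \in S & pos S x = i by apply: pos_surj; rewrite Sm.
have [y yS yj] : exists2 y, y \in S & pos S y = j by apply: pos_surj; rewrite Sm.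
rewrite -xi -yj !nth_subword // xi yj.
rewrite -[nat_of_ord i]/(nat_of_ord (Ordinal im)) -[nat_of_ord j]/(nat_of_ord (Ordinal jm)).
rewrite !nth_word -(@pos_mono _ (tau @: S)) ?imset_f //.
by rewrite (posE _ (Ordinal im)) // (posE _ (Ordinal jm)).
Qed.

(** * Permutations with two prescribed occurrences *)

Lemma perm_extending_exists (T : finType) (s : seq T) (g : T -> T) :
  uniq s -> {in s &, injective g} -> exists p : {perm T}, {in s, p =1 g}.
Proof.
elim: s => [|x s IHs] /=; first by exists 1%g.
case/andP=> xs us ginj; have [|p pg] := IHs us.
  by move=> a b as_ bs; apply: ginj; rewrite inE ?as_ ?bs orbT.
(* Products act from left to right: the transposition moves [p x] to [g x] and fixes [p y = g y] for
   [y] in [s], by injectivity of [p] and of [g]. *)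
exists (p * tperm (p x) (g x))%g => y; rewrite inE permM.
case: eqVneq => [-> _|yx /= ys]; first by rewrite tpermL.
rewrite -(pg y ys) tpermD //; first by apply: contra yx => /eqP/perm_inj ->.
apply: contra yx => /eqP; rewrite pg // => /ginj -> //; rewrite inE ?eqxx //.
by rewrite ys orbT.
Qed.

(** The solutions form a coset: given one solution [p], they are the products [q * p] with [q]
    fixing [U] pointwise. *)
Lemma card_perm_extending (T : finType) (U : {set T}) (g : T -> T) :
  {in U &, injective g} ->
  #|[set s : {perm T} | [forall x in U, s x == g x]]| = (#|T| - #|U|)`!.
Proof.
move=> ginj; have [||p pg] := @perm_extending_exists _ (enum U) g.
- exact: enum_uniq.
- by move=> x y; rewrite !mem_enum; apply: ginj.
have -> : #|T| - #|U| = #|~: U| by rewrite [RHS]cardsCs setCK.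
rewrite -card_perm -(card_imset (perm_on (~: U)) (mulIg p)).
apply: eq_card => s; rewrite inE; apply/forall_inP/imsetP => [sg|[q]].
  exists (s * p^-1)%g; last by rewrite mulgKV.
  rewrite unfold_in /=; apply/subsetP => x; rewrite !inE; apply: contra => xU.
  by rewrite permM (eqP (sg x xU)) -pg ?mem_enum // permK.
move=> qU -> x xU; rewrite permM (out_perm qU) ?inE ?xU //.
by rewrite pg ?mem_enum.
Qed.

(* The increasing bijections from [S] and [A] to 'I_m turn [pi] into this map
   from [S] to [A]; outside [S] its values are irrelevant. *)
Definition transport m n (pi : 'S_m) (S A : {set 'I_n}) (x : 'I_n) : 'I_n :=
  nth x (enum A) (oapp (fun i => nat_of_ord (pi i)) 0 (insub (pos S x))).

Lemma transportP m n (pi : 'S_m) (S A : {set 'I_n}) x (i : 'I_m) :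
  #|A| = m -> pos S x = i ->
  transport pi S A x \in A /\ pos A (transport pi S A x) = pi i.
Proof.
move=> Am xi; rewrite /transport xi valK /=.
split; last by rewrite pos_nth_enum // Am.
by rewrite -mem_enum mem_nth // -cardE Am.
Qed.

Lemma exists_rank m n (S : {set 'I_n}) x :
  #|S| = m -> x \in S -> exists i : 'I_m, pos S x = i.
Proof. by move=> Sm /ltn_pos; rewrite Sm => xm; exists (Ordinal xm). Qed.

Lemma mem_transport m n (pi : 'S_m) (S A : {set 'I_n}) x :
  #|S| = m -> #|A| = m -> x \in S -> transport pi S A x \in A.
Proof.
by move=> Sm Am /(exists_rank Sm)[i xi]; have [] := transportP pi Am xi.
Qed.

Lemma transport_inj m n (pi : 'S_m) (S A : {set 'I_n}) :
  #|S| = m -> #|A| = m -> {in S &, injective (transport pi S A)}.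
Proof.
move=> Sm Am x y xS yS; have [i xi] := exists_rank Sm xS.
have [j yj] := exists_rank Sm yS => e.
have := (transportP pi Am xi).2; rewrite e (transportP pi Am yj).2.
by move=> /val_inj/perm_inj ji; apply: (@pos_inj _ S); rewrite // xi yj ji.
Qed.

(** Once the set of values is prescribed, an occurrence leaves no freedom on [S]: the rank of a
    position fixes the rank of its value in [A], hence the value. *)
Lemma occurrence_transport m n (pi : 'S_m) (tau : 'S_n) (S A : {set 'I_n}) :
  #|S| = m -> #|A| = m ->
  (occurrence pi tau S && (tau @: S == A))
  = [forall x in S, tau x == transport pi S A x].
Proof.
move=> Sm Am; apply/andP/forall_inP => [[/occurrenceP[_ occ] /eqP SA] x xS|h].
  have [i xi] := exists_rank Sm xS; have [yA yi] := transportP pi Am xi.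
  apply/eqP/(@pos_inj _ A); rewrite // -?SA ?imset_f //.
  by rewrite (occ x i) // SA yi.
have SA : tau @: S = A.
  apply/eqP; rewrite eqEcard card_imset ?Sm ?Am ?leqnn ?andbT; last exact: perm_inj.
  by apply/subsetP => _ /imsetP[x xS ->]; rewrite (eqP (h x xS)) mem_transport.
split; last by rewrite SA.
apply/occurrenceP; split=> // x i xS xi.
by rewrite SA (eqP (h x xS)) (transportP pi Am xi).2.
Qed.

Lemma card_occurrence m n (pi : 'S_m) (S : {set 'I_n}) : #|S| = m ->
  #|[set tau : 'S_n | occurrence pi tau S]| = 'C(n, m) * (n - m)`!.
Proof.
move=> Sm; rewrite -sum1dep_card.
rewrite (partition_big (fun tau : 'S_n => tau @: S) (fun A => #|A| == m)) /=; last first.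
  by move=> tau _; rewrite card_imset ?Sm //; apply: perm_inj.
rewrite (eq_bigr (fun=> (n - m)`!)) => [|A /eqP Am].
  by rewrite sum_nat_cond_const card_draws card_ord.
have := card_perm_extending (@transport_inj _ _ pi _ _ Sm Am).
rewrite sum1dep_card card_ord Sm => <-.
by apply: eq_card => tau; rewrite !inE occurrence_transport.
Qed.

Definition joint m n (pi1 pi2 : 'S_m) (S T : {set 'I_n}) : {set 'S_n} :=
  [set tau : 'S_n | occurrence pi1 tau S && occurrence pi2 tau T].

(** The two transports agree on [S :&: T] and glue to an injective map on [S :|: T]; the
    permutations sought are its extensions. *)
Lemma card_joint_fiber m n (pi1 pi2 : 'S_m) (S T A B : {set 'I_n}) :
  #|S| = m -> #|T| = m -> #|A| = m -> #|B| = m -> #|A :&: B| = #|S :&: T| ->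
  {in S :&: T, transport pi1 S A =1 transport pi2 T B} ->
  #|[set tau in joint pi1 pi2 S T | (tau @: S == A) && (tau @: T == B)]|
  = (n - #|S :|: T|)`!.
Proof.
move=> Sm Tm Am Bm AB_ST agree.
set gS := transport pi1 S A; set gT := transport pi2 T B.
have gSinj : {in S &, injective gS} by apply: transport_inj.
have gTinj : {in T &, injective gT} by apply: transport_inj.
have gSA x : x \in S -> gS x \in A by apply: mem_transport.
have gTB x : x \in T -> gT x \in B by apply: mem_transport.
(* Equal cardinalities turn the inclusion into an equality, so a value in both [A] and [B] comes
   from a common position. This rules out collisions between [S] and [T] in the glued map. *)
have gST : gS @: (S :&: T) = A :&: B.
  apply/eqP; rewrite eqEcard AB_ST card_in_imset ?leqnn ?andbT; last first.
    by move=> x y /setIP[xS _] /setIP[yS _]; apply: gSinj.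
  apply/subsetP => _ /imsetP[x xST ->]; have [xS xT] := setIP xST.
  by rewrite inE gSA // /gS agree // gTB.
have mixed x y : x \in S -> y \in T -> gS x = gT y -> y \in S.
  move=> xS yT e; have : gS x \in A :&: B by rewrite inE gSA //= e gTB.
  rewrite -gST => /imsetP[z zST]; have [zS zT] := setIP zST.
  by rewrite e /gS agree // => /gTinj -> //.
pose g x := if x \in S then gS x else gT x.
have gT_E : {in T, g =1 gT}.
  by move=> x xT; rewrite /g; case: ifP => // xS; apply: agree; rewrite inE xS.
have ginj : {in S :|: T &, injective g}.
  move=> x y; rewrite !inE /g.
  case: ifPn => xS; case: ifPn => yS //= xT yT e.
  - exact: gSinj.
  - by rewrite (mixed _ _ xS yT e) in yS.
  - by rewrite (mixed _ _ yS xT (esym e)) in xS.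
  - exact: gTinj.
have := card_perm_extending ginj; rewrite card_ord => <-; apply: eq_card => tau.
rewrite !inE andbACA !occurrence_transport //.
apply/andP/forall_inP => [[/forall_inP hS /forall_inP hT] x|h].
  by rewrite inE => /orP[xS|xT]; [rewrite /g xS hS|rewrite gT_E ?hT].
split; apply/forall_inP => x xI; have := h x; rewrite inE xI ?orbT => /(_ isT).
  by rewrite /g xI.
by rewrite gT_E.
Qed.

(** Serves for pairs of position sets and for pairs of value sets alike, so that one count covers
    both. *)
Definition meet_at m n (i j : nat) : {set {set 'I_n} * {set 'I_n}} :=
  [set ST : {set 'I_n} * {set 'I_n} | [&& #|ST.1| == m, #|ST.2| == m &
    [exists c, [&& ST.1 :&: ST.2 == [set c], pos ST.1 c == i & pos ST.2 c == j]]]].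

Lemma meet_atP m n i j (S T : {set 'I_n}) :
  reflect [/\ #|S| = m, #|T| = m &
             exists c, [/\ S :&: T = [set c], pos S c = i & pos T c = j]]
          ((S, T) \in meet_at m n i j).
Proof.
rewrite inE /=; apply: (iffP and3P) => [[/eqP Sm /eqP Tm /existsP[c]]|].
  by case/and3P=> /eqP ? /eqP ? /eqP ?; split=> //; exists c.
case=> /eqP Sm /eqP Tm [c [/eqP e1 /eqP e2 /eqP e3]]; split=> //.
by apply/existsP; exists c; rewrite e1 e2 e3.
Qed.

Lemma card_jointE m n (pi1 pi2 : 'S_m) (S T : {set 'I_n})
    (Q : {set {set 'I_n} * {set 'I_n}}) k :
  {in joint pi1 pi2 S T, forall tau : 'S_n, (tau @: S, tau @: T) \in Q} ->
  {in Q, forall AB, #|[set tau in joint pi1 pi2 S T |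
     (tau @: S == AB.1) && (tau @: T == AB.2)]| = k} ->
  #|joint pi1 pi2 S T| = #|Q| * k.
Proof.
move=> jQ Qk; rewrite -sum1_card.
rewrite (partition_big (fun tau : 'S_n => (tau @: S, tau @: T)) [in Q]) //=.
rewrite -sum_nat_const; apply: eq_bigr => AB /Qk <-.
by rewrite sum1dep_card.
Qed.

Lemma card_joint_meet m n (pi1 pi2 : 'S_m) (i j : 'I_m) (S T : {set 'I_n}) :
  (S, T) \in meet_at m n i j ->
  #|joint pi1 pi2 S T| = #|meet_at m n (pi1 i) (pi2 j)| * (n - (2 * m - 1))`!.
Proof.
case/meet_atP=> Sm Tm [c [STc ci cj]].
have [cS cT] : c \in S /\ c \in T by apply/setIP; rewrite STc set11.
apply: card_jointE => [tau|[A B] /meet_atP[Am Bm [d [ABd di dj]]]].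
  rewrite inE => /andP[/occurrenceP[_ occ1] /occurrenceP[_ occ2]].
  apply/meet_atP; rewrite !card_imset ?Sm ?Tm; try exact: perm_inj.
  split=> //; exists (tau c); rewrite (occ1 c i) // (occ2 c j) //; split=> //.
  by rewrite -imsetI ?STc ?imset_set1 // => ? ? _ _; apply: perm_inj.
rewrite card_joint_fiber //=.
- by rewrite cardsU STc cards1 Sm Tm mul2n addnn.
- by rewrite ABd STc !cards1.
have [dA dB] : d \in A /\ d \in B by apply/setIP; rewrite ABd set11.
move=> x; rewrite STc inE => /eqP->.
have [h1 h2] := transportP pi1 Am ci; have [h3 h4] := transportP pi2 Bm cj.
(* Both transports send [c] to [d], the only element of rank [pi1 i] in [A] and the only one of rank
   [pi2 j] in [B]. *)
transitivity d; [apply: (@pos_inj _ A)|apply: (@pos_inj _ B)] => //.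
  by rewrite h2 di.
by rewrite h4 dj.
Qed.

Definition disjoint_pairs m n : {set {set 'I_n} * {set 'I_n}} :=
  [set ST : {set 'I_n} * {set 'I_n} | [&& #|ST.1| == m, #|ST.2| == m & ST.1 :&: ST.2 == set0]].

Lemma card_joint_disjoint m n (pi1 pi2 : 'S_m) (S T : {set 'I_n}) :
  (S, T) \in disjoint_pairs m n ->
  #|joint pi1 pi2 S T| = #|disjoint_pairs m n| * (n - 2 * m)`!.
Proof.
rewrite inE => /and3P[/eqP Sm /eqP Tm /eqP ST0].
apply: card_jointE => [tau _|[A B]]; rewrite inE /=.
  rewrite !card_imset ?Sm ?Tm; try exact: perm_inj.
  rewrite !eqxx /= -imsetI ?ST0 ?imset0 // => ? ? _ _; exact: perm_inj.
case/and3P=> /eqP Am /eqP Bm /eqP AB0.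
rewrite card_joint_fiber //=.
- by rewrite cardsU ST0 cards0 Sm Tm mul2n addnn subn0.
- by rewrite AB0 ST0.
by move=> x; rewrite ST0 inE.
Qed.

Lemma card_disjoint_pairs m n :
  #|disjoint_pairs m n| = 'C(n, m) * 'C(n - m, m).
Proof.
rewrite -sum1dep_card.
transitivity (\sum_(S : {set 'I_n} | #|S| == m)
   \sum_(T : {set 'I_n} | (#|T| == m) && (S :&: T == set0)) 1).
  by rewrite pair_big_dep.
rewrite (eq_bigr (fun=> 'C(n - m, m))) => [|S /eqP Sm].
  by rewrite sum_nat_cond_const card_draws card_ord.
have <- : #|~: S| = n - m by rewrite cardsCs setCK card_ord Sm.
rewrite sum1dep_card -cards_draws.
apply: eq_card => T; rewrite !inE andbC; congr (_ && _).
by rewrite setI_eq0 disjoints_subset subsetC.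
Qed.

(** * Counting pairs of sets *)

(** Sorts the sets of size [a + b + 1] by their element [c] of rank [a], with [a] elements below it
    and [b] above. The proof is by induction on [n] with Pascal's rule. *)
Lemma sum_bin_bin n a b :
  \sum_(c < n) 'C(c, a) * 'C(n - c.+1, b) = 'C(n, a + b + 1).
Proof.
elim: n b => [|n IHn] b; first by rewrite big_ord0 addn1.
rewrite big_ord_recr /= subnn addn1 binS; case: b => [|b].
  rewrite -[in X in _ = X + _](addn1 (a + 0)) -IHn addn0 bin0 muln1.
  by congr (_ + _); apply: eq_bigr => c _; rewrite !bin0.
rewrite bin0n muln0 addn0 -[in X in _ = X + _](addn1 (a + b.+1)) -IHn.
rewrite addnS -(addn1 (a + b)) -IHn -big_split; apply: eq_bigr => c _ /=.
by rewrite subSn // binS mulnDr.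
Qed.

(** Both sides count the pairs of disjoint sets of sizes [a] and [b]: choose them in turn, or choose
    the union and then split it. *)
Lemma mul_bin_bin n a b : 'C(n, a) * 'C(n - a, b) = 'C(n, a + b) * 'C(a + b, a).
Proof.
have [abn|nab] := leqP (a + b) n; last first.
  rewrite (bin_small nab) mul0n; have [an|na] := leqP a n; last by rewrite bin_small.
  by rewrite (@bin_small (n - a)) ?muln0 //; lia.
have an : a <= n by lia.
apply/eqP; rewrite -(@eqn_pmul2r (a`! * b`! * (n - (a + b))`!));
  last by rewrite !muln_gt0 !fact_gt0.
have h1 := bin_fact an; have h2 : 'C(n - a, b) * (b`! * (n - (a + b))`!) = (n - a)`!.
  by rewrite subnDA bin_fact //; lia.
have h3 := bin_fact abn; have h4 : 'C(a + b, a) * (a`! * b`!) = (a + b)`!.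
  by rewrite -[in b`!](addKn a b) bin_fact // leq_addr.
apply/eqP; transitivity n`!; first by rewrite -h1 -h2; lia.
by rewrite -h3 -h4; lia.
Qed.

(** Such a set is [c] together with independent choices inside [W] and [W']. These will be the
    elements below and above [c], with or without those of a given set removed. *)
Lemma card_draws_above_below (T : finType) (W W' : {set T}) c i i' :
  [disjoint W & W'] -> c \notin W -> c \notin W' ->
  #|[set S : {set T} | [&& c \in S, S \subset c |: (W :|: W'),
                         #|S :&: W| == i & #|S :&: W'| == i']]|
  = 'C(#|W|, i) * 'C(#|W'|, i').
Proof.
move=> dWW cW cW'; rewrite -!cards_draws -cardsX.
have WW x : x \in W -> x \in W' -> false by move=> xW; rewrite (disjointFr dWW).
have UIW (X Y : {set T}) : X \subset W -> Y \subset W' ->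
    (c |: (X :|: Y)) :&: W = X /\ (c |: (X :|: Y)) :&: W' = Y.
  move=> /subsetP XW /subsetP YW; split; apply/setP => x; rewrite !inE.
    case: eqVneq => [->|_] /=; first by rewrite (negPf cW);
      case: (boolP (c \in X)) => // /XW; rewrite (negPf cW).
    apply/andP/idP => [[/orP[]// /YW xW' /WW/(_ xW')]//|xX]; by rewrite xX XW.
  case: eqVneq => [->|_] /=; first by rewrite (negPf cW');
    case: (boolP (c \in Y)) => // /YW; rewrite (negPf cW').
  apply/andP/idP => [[/orP[]// /XW/WW h /h]//|xX]; by rewrite xX YW ?orbT.
rewrite -(@card_in_imset _ _ (fun XY : {set T} * {set T} => c |: (XY.1 :|: XY.2)));
  last first.
  case=> [X Y] [X1 Y1]; rewrite !inE /= => /andP[/andP[XW _] /andP[YW _]].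
  move=> /andP[/andP[XW1 _] /andP[YW1 _]] e.
  have [h1 h2] := UIW _ _ XW YW; have [h3 h4] := UIW _ _ XW1 YW1.
  by congr (_, _); [rewrite -h1 e h3|rewrite -h2 e h4].
apply: eq_card => S; rewrite inE; apply/and4P/imsetP => [[cS SU /eqP Si /eqP Si']|].
  exists (S :&: W, S :&: W'); first by rewrite !inE /= !subsetIr Si Si' !eqxx.
  apply/setP => x; rewrite !inE -andb_orr; case: eqVneq => [->//|xc] /=.
  by case: (boolP (x \in S)) => // /(subsetP SU); rewrite !inE (negPf xc) /= => ->.
case=> [[X Y]]; rewrite !inE /= => /andP[/andP[XW /eqP Xi] /andP[YW /eqP Yi]] ->.
have [-> ->] := UIW _ _ XW YW; rewrite Xi Yi !eqxx setU11; split=> //.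
by apply: setUS; apply: setUSS.
Qed.

Definition below n (c : 'I_n) : {set 'I_n} := [set x : 'I_n | x < c].
Definition above n (c : 'I_n) : {set 'I_n} := [set x : 'I_n | c < x].

Lemma card_below n (c : 'I_n) : #|below c| = c.
Proof.
transitivity (nat_of_ord ((1%g : 'S_n) c)); last by rewrite perm1.
by rewrite -card_perm_lt; apply: eq_card => x; rewrite !inE !perm1.
Qed.

Lemma setUC1_below_above n (c : 'I_n) : ~: [set c] = below c :|: above c.
Proof. by apply/setP => x; rewrite !inE -neq_ltn. Qed.

Lemma disjoint_below_above n (c : 'I_n) : [disjoint below c & above c].
Proof.
rewrite disjoints_subset; apply/subsetP => x; rewrite !inE => xc.
by rewrite -leqNgt ltnW.
Qed.

Lemma cards_below_above n (c : 'I_n) (S : {set 'I_n}) :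
  #|S| = (c \in S) + pos S c + #|S :&: above c|.
Proof.
rewrite (cardsD1 c) -addnA; congr (_ + _).
have -> : pos S c = #|S :&: below c| by apply: eq_card => x; rewrite !inE.
rewrite -(cardsID (below c) (S :\ c)); congr (_ + _); apply: eq_card => x; rewrite !inE.
  by case: eqVneq => [->|]; rewrite ?ltnn ?andbF.
by rewrite -leqNgt [c < x]ltn_neqAle (inj_eq val_inj) eq_sym andbA andbC [_ && (c != x)]andbC.
Qed.

Lemma card_above n (c : 'I_n) : #|above c| = n - c.+1.
Proof.
have := cards_below_above c setT; rewrite setTI cardsT card_ord inE.
have -> : pos setT c = c by rewrite -[RHS]card_below; apply: eq_card => x; rewrite !inE.
by rewrite add1n => e; rewrite [X in X - _]e addKn.
Qed.

Definition sets_with_rank m n i (c : 'I_n) : {set {set 'I_n}} :=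
  [set S : {set 'I_n} | [&& #|S| == m, c \in S & pos S c == i]].

Lemma card_sets_with_rank m n i (c : 'I_n) : i < m ->
  #|sets_with_rank m i c| = 'C(c, i) * 'C(n - c.+1, m - i.+1).
Proof.
move=> im; rewrite -{1}card_below -card_above -(@card_draws_above_below _ _ _ c).
- apply: eq_card => S; rewrite !inE -setUC1_below_above setUCr subsetT /=.
  rewrite (cards_below_above c).
  have -> : pos S c = #|S :&: below c| by apply: eq_card => x; rewrite !inE.
  case: (c \in S); last by rewrite andbF.
  rewrite /= andbC; case: eqP => //= ->; move: #|S :&: above c| => k; apply/eqP/eqP; lia.
- exact: disjoint_below_above.
- by rewrite inE ltnn.
- by rewrite inE ltnn.
Qed.

(** Away from [c], the set [T] must avoid [S], which already occupies [i] of the places below [c]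
    and [m - i.+1] of those above. *)
Lemma card_meeting_sets m n i j (c : 'I_n) (S : {set 'I_n}) :
  S \in sets_with_rank m i c -> j < m ->
  #|[set T in sets_with_rank m j c | S :&: T == [set c]]|
  = 'C(c - i, j) * 'C(n - c.+1 - (m - i.+1), m - j.+1).
Proof.
rewrite inE => /and3P[/eqP Sm cS /eqP ci] jm.
have := cards_below_above c S; rewrite Sm cS ci => Sabove.
have SI (c1 : 'I_n) : pos S c1 = #|S :&: below c1| by apply: eq_card => x; rewrite !inE.
have <- : #|below c :\: S| = c - i by rewrite cardsD card_below setIC -SI ci.
have <- : #|above c :\: S| = n - c.+1 - (m - i.+1).
  by rewrite cardsD card_above setIC; congr (_ - _); lia.
rewrite -(@card_draws_above_below _ _ _ c); last 3 first.
- rewrite disjoints_subset; apply: subset_trans (subsetDl _ _) _.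
  have := disjoint_below_above c; rewrite disjoints_subset => /subset_trans; apply.
  by rewrite setCS subsetDl.
- by rewrite !inE ltnn andbF.
- by rewrite !inE ltnn andbF.
apply: eq_card => T; rewrite !inE andbC andbA.
have -> : (c |: (below c :\: S :|: above c :\: S)) = c |: ~: S.
  apply/setP => x; rewrite !inE -andb_orr -neq_ltn (inj_eq val_inj).
  by case: eqVneq => //=; rewrite andbT.
have -> : (T \subset c |: ~: S) = (S :&: T \subset [set c]).
  apply/subsetP/subsetP => h x; rewrite ?inE.
    by case/andP=> xS /h; rewrite !inE xS orbF.
  by move=> xT; have := h x; rewrite !inE xT andbT; case: (x \in S) => //;
    [move/(_ isT) ->|rewrite orbT].
have [cT|cT] := boolP (c \in T); last first.
  by rewrite /= !andbF.
have -> : (S :&: T == [set c]) = (S :&: T \subset [set c]).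
  by rewrite eqEsubset sub1set in_setI cS cT !andbT.
rewrite /= -andbA; have [/subsetP sub|//] := boolP (_ \subset _).
have e (X : {set 'I_n}) : c \notin X -> T :&: (X :\: S) = T :&: X.
  move=> cX; apply/setP => x; rewrite !inE; case: (boolP (x \in S)) => //= xS.
  rewrite andbF; apply/esym/negbTE/negP => /andP[xT xX]; have := sub x;
    rewrite !inE xS xT => /(_ isT)/eqP xc.
  by rewrite -xc xX in cX.
rewrite !e ?inE ?ltnn // (cards_below_above c T) cT.
have -> : pos T c = #|T :&: below c| by apply: eq_card => x; rewrite !inE.
rewrite /= andbC; case: eqP => //= ->; move: #|T :&: above c| => k; apply/eqP/eqP; lia.
Qed.

(** Sum over the common element [c]. By [mul_bin_bin], a pair amounts to its union and a
    distribution of the other elements, below and above [c], among the two sets. The distributions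
    number [bracket], whatever [c] is, and [sum_bin_bin] counts the unions. *)
Lemma card_meet_at m n i j : i < m -> j < m ->
  #|meet_at m n i j| = 'C(n, 2 * m - 1) * bracket m i.+1 j.+1.
Proof.
move=> im jm.
pose P c := [set ST : {set 'I_n} * {set 'I_n} | [&& ST.1 \in sets_with_rank m i c,
  ST.2 \in sets_with_rank m j c & ST.1 :&: ST.2 == [set c]]].
transitivity (\sum_(c : 'I_n) #|P c|).
  rewrite -sum1_card; under [RHS]eq_bigr do rewrite -sum1_card.
  rewrite [RHS](exchange_big_dep [in meet_at m n i j]) /=; last first.
    move=> c [S T] _ STP; rewrite inE /= !inE in STP.
    case/and3P: STP => /and3P[/eqP ? cS /eqP ?] /and3P[/eqP ? cT /eqP ?] /eqP ?.
    by apply/meet_atP; split=> //; exists c.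
  apply: eq_bigr => [[S T]] /meet_atP[Sm Tm [c [STc ci cj]]].
  rewrite (big_pred1 c) // => d; rewrite inE /= !inE Sm Tm STc !eqxx /=.
  have [cS cT] : c \in S /\ c \in T by apply/setIP; rewrite STc set11.
  rewrite (inj_eq (@set1_inj _)).
  by case: (eqVneq c d) => [<-|]; rewrite ?andbF // cS cT ci cj !eqxx.
have Pc c : #|P c| = 'C(c, i + j) * 'C(n - c.+1, m - i.+1 + (m - j.+1)) * bracket m i.+1 j.+1.
  rewrite -sum1dep_card.
  transitivity (\sum_(S in sets_with_rank m i c)
    \sum_(T | (T \in sets_with_rank m j c) && (S :&: T == [set c])) 1).
    by rewrite pair_big_dep.
  under eq_bigr => S SP do rewrite sum1dep_card (card_meeting_sets SP jm).
  rewrite sum_nat_const card_sets_with_rank // mulnACA !mul_bin_bin /bracket.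
  by rewrite !subn1 /= mulnACA.
under eq_bigr do rewrite Pc; rewrite -big_distrl /= sum_bin_bin; congr ('C(_, _) * _).
by lia.
Qed.

(** Every row has the same sum: row [i] is [sum_bin_bin] for sets of size [m] in [2 * m - 1]
    elements, with [c = i + j]. The terms with [c < i] or [c >= i + m] vanish. *)
Lemma sum_bracket m : 0 < m ->
  \sum_(i < m) \sum_(j < m) bracket m i.+1 j.+1 = m * 'C(2 * m - 1, m).
Proof.
move=> m0; rewrite -[m in m * _]card_ord -sum_nat_const; apply: eq_bigr => i _.
have im := ltn_ord i.
have -> : 'C(2 * m - 1, m) = 'C(2 * m - 1, i + (m - i.+1) + 1) by congr 'C(_, _); lia.
rewrite -sum_bin_bin -(big_mkord xpredT (fun c => 'C(c, i) * 'C(2 * m - 1 - c.+1, m - i.+1))).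
rewrite (big_cat_nat (n := i)) //=; last by lia.
rewrite [X in _ = X + _]big_nat_cond [X in _ = X + _]big1 => [|c /andP[/andP[_ ci] _]];
  last by rewrite bin_small.
rewrite add0n (big_cat_nat (n := i + m)) //=; [|lia|lia].
rewrite [X in _ = _ + X]big_nat_cond [X in _ = _ + X]big1 => [|c /andP[/andP[h1 h2] _]]; last first.
  by rewrite (@bin_small (_ - _)) ?muln0 //; lia.
have shift k (G : nat -> nat) : \sum_(k <= c < k + m) G c = \sum_(j < m) G (j + k).
  by rewrite -{1}[k]add0n big_addn addKn big_mkord.
rewrite addn0 shift.
apply: eq_bigr => j _; rewrite /bracket !subn1 /= (addnC j i); congr (_ * 'C(_, _)).
have := ltn_ord j; lia.
Qed.

(* A pair is encoded by an enumeration of its union, with repetitions, and two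
   subsets of the index set 'I_k. *)
Lemma leq_card_pairs n k (P : {set {set 'I_n} * {set 'I_n}}) :
  {in P, forall ST, 0 < #|ST.1 :|: ST.2| <= k} -> #|P| <= n ^ k * (2 ^ k * 2 ^ k).
Proof.
move=> Pk.
pose h (F : {ffun 'I_k -> 'I_n} * ({set 'I_k} * {set 'I_k})) :=
  (F.1 @: F.2.1, F.1 @: F.2.2).
have -> : n ^ k * (2 ^ k * 2 ^ k)
    = #|{: {ffun 'I_k -> 'I_n} * ({set 'I_k} * {set 'I_k})}|.
  by rewrite !card_prod card_ffun -!cardsT -!powersetT !card_powerset !cardsT !card_ord.
apply: leq_trans (leq_imset_card h _); apply: subset_leq_card.
apply/subsetP => [[S T]] /Pk /=; set U := S :|: T => /andP[/card_gt0P[x0 _] Uk].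
(* Indices beyond the size of [U] get the default [x0]. This is harmless, since a subset of [U] is
   recovered as the image of its full preimage. *)
pose f : {ffun 'I_k -> 'I_n} := [ffun i : 'I_k => nth x0 (enum U) i].
have fK (X : {set 'I_n}) : X \subset U -> f @: (f @^-1: X) = X.
  move=> XU; apply/setP => x; apply/imsetP/idP => [[i]|xX]; first by rewrite inE => iX ->.
  have xU : x \in enum U by rewrite mem_enum (subsetP XU).
  have ik : index x (enum U) < k by apply: leq_trans Uk; rewrite cardE index_mem.
  by exists (Ordinal ik); rewrite ?inE ffunE /= nth_index.
apply/imsetP; exists (f, (f @^-1: S, f @^-1: T)) => //.
by rewrite /h /= !fK ?subsetUl ?subsetUr.
Qed.

Definition pairs m n : {set {set 'I_n} * {set 'I_n}} :=
  [set ST : {set 'I_n} * {set 'I_n} | (#|ST.1| == m) && (#|ST.2| == m)].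

Definition big_meets m n : {set {set 'I_n} * {set 'I_n}} :=
  [set ST in pairs m n | 1 < #|ST.1 :&: ST.2|].

(** Two common elements leave at most [2 * m - 2] in the union, whence the exponent of the error
    term. *)
Lemma leq_card_big_meets m n : 0 < m ->
  #|big_meets m n| <= 4 ^ (2 * m - 2) * n ^ (2 * m - 2).
Proof.
move=> m0; apply: leq_trans (leq_card_pairs _) _; last first.
  by rewrite mulnC -expnMn.
move=> [S T]; rewrite !inE /= => /andP[/andP[/eqP Sm /eqP Tm] I2].
have := subset_leq_card (subsetUl S T); rewrite cardsU Sm Tm.
move: #|_ :&: _| I2 => k; lia.
Qed.

Lemma card_pairs m n : #|pairs m n| = 'C(n, m) ^ 2.
Proof.
have -> : pairs m n = setX [set S : {set 'I_n} | #|S| == m] [set T : {set 'I_n} | #|T| == m].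
  by apply/setP => [[S T]]; rewrite !inE.
by rewrite cardsX !card_draws !card_ord mulnn.
Qed.

(** * Moments of the number of occurrences, and auxiliary estimates *)

Lemma occurrence_card m n (pi : 'S_m) (tau : 'S_n) (S : {set 'I_n}) :
  occurrence pi tau S -> #|S| == m.
Proof. by case/andP. Qed.

Lemma sum_nb_occ m n (pi : 'S_m) :
  \sum_(tau : 'S_n) nb_occ pi tau = 'C(n, m) * ('C(n, m) * (n - m)`!).
Proof.
rewrite /nb_occ; under eq_bigr do rewrite -sum1dep_card.
rewrite (exchange_big_dep (fun S : {set 'I_n} => #|S| == m)) /=; last first.
  by move=> tau S _; apply: occurrence_card.
rewrite (eq_bigr (fun=> 'C(n, m) * (n - m)`!)) => [|S /eqP Sm].
  by rewrite sum_nat_cond_const card_draws card_ord.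
by rewrite sum1dep_card (card_occurrence pi Sm).
Qed.

Lemma sum_nb_occM m n (pi1 pi2 : 'S_m) :
  \sum_(tau : 'S_n) nb_occ pi1 tau * nb_occ pi2 tau
  = \sum_(ST in pairs m n) #|joint pi1 pi2 ST.1 ST.2|.
Proof.
have E (tau : 'S_n) : nb_occ pi1 tau * nb_occ pi2 tau =
    \sum_(ST | occurrence pi1 tau ST.1 && occurrence pi2 tau ST.2) 1.
  rewrite sum1dep_card -cardsX; apply: eq_card => [[S T]]; by rewrite !inE.
rewrite (eq_bigr _ (fun tau _ => E tau)).
rewrite (exchange_big_dep [in pairs m n]) /=; last first.
  by move=> tau [S T] _ /andP[/occurrence_card S1 /occurrence_card T1]; rewrite inE S1.
by apply: eq_bigr => ST _; rewrite sum1dep_card.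
Qed.

Lemma leq_ffact_expn n k : n ^_ k <= n ^ k.
Proof.
elim: k => [|k IHk]; first by rewrite ffactn0.
by rewrite ffactnSr expnSr leq_mul // leq_subr.
Qed.

(** Lets the falling factorial in the main term be replaced by a power. The constant is crude but
    fits the induction, as [(k+1)^2 + (k+1) <= (k+2)^2]. *)
Lemma leq_expn_ffact n k : n ^ k.+1 <= n ^_ k.+1 + k.+1 ^ 2 * n ^ k.
Proof.
elim: k => [|k IHk]; first by rewrite ffactn1 expn1 leq_addr.
rewrite (ffactnSr n k.+1) -(mulnn k.+2).
have := leq_ffact_expn n k.+1; move: IHk;
  rewrite -(mulnn k.+1) (expnS n k.+1) (expnS n k).
move: (n ^_ k.+1) (n ^ k) => F E IH FE.
have h1 : F * n <= F * (n - k.+1) + F * k.+1 by rewrite -mulnDr leq_mul2l; lia.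
have h2 : n * (n * E) <= n * (F + k.+1 * k.+1 * E) by rewrite leq_mul2l IH orbT.
have h3 : F * k.+1 <= n * E * k.+1 by rewrite leq_mul2r FE orbT.
by move: (n - k.+1) h1 => d h1; nia.
Qed.

Lemma bracketC m i j : bracket m i j = bracket m j i.
Proof.
have binC a b : 'C(a + b, a) = 'C(b + a, b).
  by rewrite addnC -(@bin_sub _ b) ?leq_addr // addKn.
by rewrite /bracket (binC (i - 1)) (binC (m - i)).
Qed.

(** * The covariance *)

Import Order.TTheory GRing.Theory Num.Theory.
Local Open Scope ring_scope.

Lemma unif_covarianceE (R : numFieldType) (T : finType) (X Y : T -> R) :
  (0 < #|T|)%N ->
  unif_covariance X Y = (\sum_t X t * Y t) / #|T|%:R
    - ((\sum_t X t) / #|T|%:R) * ((\sum_t Y t) / #|T|%:R).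
Proof.
move=> T0; have N0 : #|T|%:R != 0 :> R by rewrite pnatr_eq0 -lt0n.
rewrite /unif_covariance /unif_expectation.
set a := (\sum_t X t) / _; set b := (\sum_t Y t) / _.
have -> : \sum_t (X t - a) * (Y t - b) = \sum_t X t * Y t - #|T|%:R * (a * b).
  rewrite (eq_bigr (fun t => X t * Y t - (X t * b + a * Y t - a * b)));
    last by move=> t _; ring.
  rewrite sumrB; congr (_ - _); rewrite sumrB big_split /= -big_distrl -big_distrr /=.
  rewrite sumr_const /a /b -mulr_natl -[X in X - _]/(_ + _).
  by field.
by field.
Qed.

Section Covariance.
Variables (R : realFieldType) (m n : nat) (pi1 pi2 : 'S_m).

(** For [m]-sets, this is the covariance of the indicators of the two occurrences, each of
    probability [1/m!]. *)
Definition pair_cov (ST : {set 'I_n} * {set 'I_n}) : R :=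
  #|joint pi1 pi2 ST.1 ST.2|%:R / n`!%:R - 1 / m`!%:R ^+ 2.

Lemma fact_neq0 k : k`!%:R != 0 :> R.
Proof. by rewrite pnatr_eq0 -lt0n fact_gt0. Qed.

Lemma covariance_sum_pairs :
  unif_covariance (fun tau : 'S_n => (nb_occ pi1 tau)%:R : R)
                  (fun tau : 'S_n => (nb_occ pi2 tau)%:R : R)
  = \sum_(ST in pairs m n) pair_cov ST.
Proof.
have cS : #|{: 'S_n}| = n`! by rewrite card_Sn.
rewrite unif_covarianceE cS ?fact_gt0 // -!natr_sum !sum_nb_occ.
under eq_bigr do rewrite -natrM; rewrite -natr_sum sum_nb_occM.
(* The expectation of the number of occurrences; for [n < m] both sides are 0. *)
have E : ('C(n, m) * ('C(n, m) * (n - m)`!))%:R / n`!%:R = 'C(n, m)%:R / m`!%:R :> R.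
  have [mn|nm] := leqP m n; last by rewrite bin_small // !mul0r.
  rewrite -(bin_fact mn) !natrM; field.
  by rewrite !fact_neq0 pnatr_eq0 -lt0n bin_gt0 mn.
rewrite E /pair_cov sumrB -big_distrl /= -natr_sum; congr (_ - _).
rewrite sumr_const card_pairs -[X in _ = X]mulr_natl natrX; field.
exact: fact_neq0.
Qed.

Lemma normr_pair_cov_le1 ST : `|pair_cov ST| <= 1.
Proof.
have cS : #|{: 'S_n}| = n`! by rewrite card_Sn.
have /andP[a0 a1] : 0 <= (#|joint pi1 pi2 ST.1 ST.2|%:R / n`!%:R : R) <= 1.
  rewrite divr_ge0 ?ler0n //= ler_pdivrMr ?ltr0n ?fact_gt0 // mul1r ler_nat.
  by rewrite -cS max_card.
have /andP[b0 b1] : 0 <= (1 / m`!%:R ^+ 2 : R) <= 1.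
  rewrite divr_ge0 ?exprn_ge0 ?ler0n //= ler_pdivrMr ?exprn_gt0 ?ltr0n ?fact_gt0 //.
  by rewrite mul1r -natrX ler1n expn_gt0 fact_gt0.
rewrite /pair_cov ler_norml; lra.
Qed.

(** The joint count is [n!/m!^2], whatever the patterns, so the two events are independent. *)
Lemma pair_cov_disjoint ST : ST \in disjoint_pairs m n -> pair_cov ST = 0.
Proof.
case: ST => S T ST_; have := ST_; rewrite inE /= => /and3P[/eqP Sm /eqP Tm /eqP ST0].
have n2m : (2 * m <= n)%N.
  by have := max_card (mem (S :|: T)); rewrite card_ord cardsU Sm Tm ST0 cards0; lia.
rewrite /pair_cov (card_joint_disjoint _ _ ST_) card_disjoint_pairs.
have mn : (m <= n)%N by lia.
have mnm : (m <= n - m)%N by lia.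
have -> : (n - 2 * m = n - m - m)%N by lia.
rewrite -(bin_fact mn) -(bin_fact mnm) !natrM; field.
by rewrite !fact_neq0 !pnatr_eq0 -!lt0n !bin_gt0 mn mnm.
Qed.

(** The value sets contribute ['C(n, 2m-1)] times the bracket and the remaining values [(n-2m+1)!];
    after division by [n!] the dependence on [n] disappears. *)
Lemma pair_cov_meet (i j : 'I_m) ST : ST \in meet_at m n i j ->
  pair_cov ST = (bracket m (pi1 i).+1 (pi2 j).+1)%:R / (2 * m - 1)`!%:R
                - 1 / m`!%:R ^+ 2.
Proof.
case: ST => S T ST_; have /meet_atP[Sm Tm [c [STc _ _]]] := ST_.
have nm : (2 * m - 1 <= n)%N.
  by have := max_card (mem (S :|: T)); rewrite card_ord cardsU Sm Tm STc cards1; lia.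
rewrite /pair_cov (card_joint_meet _ _ ST_) card_meet_at //; congr (_ - _).
rewrite -(bin_fact nm) !natrM; field.
by rewrite !fact_neq0 pnatr_eq0 -lt0n bin_gt0 nm.
Qed.

(** The first bracket counts position sets; the second comes from the value sets. *)
Definition meet_coef : R := \sum_(i < m) \sum_(j < m) (bracket m i.+1 j.+1)%:R *
  ((bracket m (pi1 i).+1 (pi2 j).+1)%:R / (2 * m - 1)`!%:R - 1 / m`!%:R ^+ 2).

Lemma sum_pair_cov_meet :
  \sum_(ST in pairs m n | #|ST.1 :&: ST.2| == 1) pair_cov ST
  = 'C(n, 2 * m - 1)%:R * meet_coef.
Proof.
transitivity (\sum_(ij : 'I_m * 'I_m) \sum_(ST in meet_at m n ij.1 ij.2) pair_cov ST).
  rewrite (exchange_big_dep (fun ST => (ST \in pairs m n) && (#|ST.1 :&: ST.2| == 1))) /=.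
    apply: eq_bigr => [[S T]] /andP[];
      rewrite inE /= => /andP[/eqP Sm /eqP Tm] /cards1P[c STc].
    have [cS cT] : c \in S /\ c \in T by apply/setIP; rewrite STc set11.
    have [i ci] := exists_rank Sm cS; have [j cj] := exists_rank Tm cT.
    rewrite (big_pred1 (i, j)) // => [[i' j']] /=.
    apply/meet_atP/eqP => [[_ _ [d [STd di dj]]]|[-> ->]]; last by split=> //; exists c.
    have /set1_inj dc : [set d] = [set c] by rewrite -STd.
    by rewrite dc ci cj in di dj; congr (_, _); apply: val_inj.
  move=> [i j] [S T] _ /meet_atP[Sm Tm [c [STc _ _]]].
  by rewrite inE /= Sm Tm STc cards1 !eqxx.
rewrite /meet_coef pair_big big_distrr /=; apply: eq_bigr => [[i j]] _ /=.
rewrite (eq_bigr _ (@pair_cov_meet i j)) sumr_const card_meet_at //.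
by rewrite -[LHS]mulr_natl natrM mulrA.
Qed.

Lemma covariance_approx :
  `|unif_covariance (fun tau : 'S_n => (nb_occ pi1 tau)%:R : R)
                    (fun tau : 'S_n => (nb_occ pi2 tau)%:R : R)
    - 'C(n, 2 * m - 1)%:R * meet_coef| <= #|big_meets m n|%:R.
Proof.
rewrite covariance_sum_pairs -sum_pair_cov_meet.
rewrite (bigID (fun ST => #|ST.1 :&: ST.2| == 1)) /= addrAC subrr add0r.
rewrite (bigID (fun ST => #|ST.1 :&: ST.2| == 0)) /= big1 ?add0r; last first.
  move=> [S T] /andP[/andP[STp _] ST0]; apply: pair_cov_disjoint.
  by move: STp; rewrite !inE /= => /andP[-> ->]; rewrite -cards_eq0.
apply: le_trans (ler_norm_sum _ _ _) _;
  apply: (@le_trans _ _ (\sum_(ST in big_meets m n) 1)).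
  rewrite (eq_bigl [in big_meets m n]); first by apply: ler_sum => ST _;
    apply: normr_pair_cov_le1.
  by move=> ST; rewrite [in RHS]inE -andbA; congr (_ && _); case: #|_| => [|[|k]].
by rewrite sumr_const.
Qed.
End Covariance.

(** * The leading coefficient and the error bound *)

(** The permutation matrices permute the rows and columns of the second bracket matrix, so the
    [j]-th diagonal entry sums [[j,i][pi1 i, pi2 j]] over [i]; symmetry of the bracket does the
    rest. *)
Lemma pattern_traceE (R : numFieldType) m (pi1 pi2 : 'S_m) :
  pattern_trace R pi1 pi2
  = \sum_(i < m) \sum_(j < m)
      (bracket m i.+1 j.+1)%:R * (bracket m (pi1 i).+1 (pi2 j).+1)%:R.
Proof.
rewrite /pattern_trace; have -> : invmx (perm_mx pi2) = perm_mx pi2^-1 :> 'M[R]_m.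
  have pu := unitmx_perm R pi2.
  by rewrite -[LHS]mulmx1 -perm_mx1 -(mulgV pi2) perm_mxM mulKmx.
rewrite -col_permE -mulmxA -row_permE /mxtrace exchange_big /=.
apply: eq_bigr => j _; rewrite !mxE; apply: eq_bigr => i _.
by rewrite !mxE bracketC.
Qed.

(** By [sum_bracket] the subtracted constants add up to [m 'C(2m-1, m) / m!^2], which equals
    ['C(2m-1, m-1)^2 / (2m-1)!]. *)
Lemma meet_coefE (R : realFieldType) m (pi1 pi2 : 'S_m) : (0 < m)%N ->
  meet_coef R pi1 pi2 = (2 * m - 1)`!%:R * cov_coef R pi1 pi2.
Proof.
move=> m0; rewrite /cov_coef pattern_traceE.
set t := (X in _ * (X - _)).
have -> : meet_coef R pi1 pi2 = t / (2 * m - 1)`!%:R - (m * 'C(2 * m - 1, m))%:R / m`!%:R ^+ 2.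
  rewrite -sum_bracket // natr_sum /meet_coef /t !big_distrl /= -sumrB.
  apply: eq_bigr => i _; rewrite natr_sum !big_distrl /= -sumrB.
  by apply: eq_bigr => j _; ring.
have m1m : (m - 1 <= 2 * m - 1)%N by lia.
have binE : 'C(2 * m - 1, m) = 'C(2 * m - 1, m - 1).
  by rewrite -(bin_sub m1m); congr 'C(_, _); lia.
have factE : ((2 * m - 1)`! = 'C(2 * m - 1, m - 1) * (m`! * (m - 1)`!))%N.
  by rewrite -(bin_fact m1m); congr (_ * _)%N; rewrite mulnC; congr (_`! * _)%N; lia.
have mE : (m`! = m * (m - 1)`!)%N by case: (m) m0 => // k _; rewrite factS subn1.
have nz k : k`!%:R != 0 :> R by rewrite pnatr_eq0 -lt0n fact_gt0.
have bnz : 'C(2 * m - 1, m - 1)%:R != 0 :> R by rewrite pnatr_eq0 -lt0n bin_gt0.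
have mnz : m%:R != 0 :> R by rewrite pnatr_eq0 -lt0n.
rewrite binE factE mE !natrM; field.
by rewrite nz bnz mnz.
Qed.

(** The first constant bounds the pairs with at least two common positions; the second is the cost
    of replacing [n ^_ (2m-1)] by a power. *)
Lemma covariance_error (R : realFieldType) m n (pi1 pi2 : 'S_m) : (0 < m)%N ->
  `|unif_covariance (fun tau : 'S_n => (nb_occ pi1 tau)%:R : R)
                    (fun tau : 'S_n => (nb_occ pi2 tau)%:R : R)
    - cov_coef R pi1 pi2 * n%:R ^+ (2 * m - 1)|
  <= (4 ^+ (2 * m - 2) + `|cov_coef R pi1 pi2| * (2 * m - 1)%:R ^+ 2)
     * n%:R ^+ (2 * m - 2).
Proof.
move=> m0; set X := unif_covariance _ _; set c := cov_coef R pi1 pi2.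
have CE : 'C(n, 2 * m - 1)%:R * meet_coef R pi1 pi2 = c * (n ^_ (2 * m - 1))%:R.
  by rewrite meet_coefE // -bin_ffact natrM -/c; ring.
have h1 : `|X - c * (n ^_ (2 * m - 1))%:R| <= 4 ^+ (2 * m - 2) * n%:R ^+ (2 * m - 2).
  rewrite -CE; apply: le_trans (covariance_approx _ _ _ _) _.
  by rewrite -!natrX -natrM ler_nat leq_card_big_meets.
have h2 : `|(n ^_ (2 * m - 1))%:R - n%:R ^+ (2 * m - 1)| <= (2 * m - 1)%:R ^+ 2 * n%:R ^+ (2 * m - 2) :> R.
  rewrite distrC -!natrX -natrM ger0_norm ?subr_ge0 ?ler_nat ?leq_ffact_expn //.
  rewrite lerBlDl -natrD ler_nat.
  by have := leq_expn_ffact n (2 * m - 2);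
    rewrite (_ : (2 * m - 2).+1 = (2 * m - 1)%N) //; lia.
rewrite (_ : X - _ = (X - c * (n ^_ (2 * m - 1))%:R)
                     + c * ((n ^_ (2 * m - 1))%:R - n%:R ^+ (2 * m - 1))); last by ring.
apply: le_trans (ler_normD _ _) _; rewrite mulrDl lerD // normrM -mulrA.
by rewrite ler_wpM2l.
Qed.

From mathcomp Require Import all_classical all_reals all_analysis.
Import numFieldNormedType.Exports.
Local Open Scope classical_set_scope.

Theorem theorem4p4 (R : realType) (m : nat) (hm : (1 < m)%N) (pi1 pi2 : 'S_m) :
  (fun n : nat =>
     unif_covariance (fun tau : 'S_n => (nb_occ pi1 tau)%:R : R)
                     (fun tau : 'S_n => (nb_occ pi2 tau)%:R : R))
  = (fun n : nat => cov_coef R pi1 pi2 * n%:R ^+ (2 * m - 1))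
    +O_ \oo (fun n : nat => n%:R ^+ (2 * m - 2) : R)
  /\
  pattern_trace R pi1 pi2
  = \sum_(i < m) \sum_(j < m)
      (bracket m i.+1 j.+1)%:R * (bracket m (pi1 i).+1 (pi2 j).+1)%:R.
Proof.
split; last exact: pattern_traceE.
apply/eqaddOP.
(* The big-O condition asks for the bound with every constant above some threshold; the constant of
   [covariance_error] is one, and it works for all [n]. *)
exists (4 ^+ (2 * m - 2) + `|cov_coef R pi1 pi2| * (2 * m - 1)%:R ^+ 2).
split; first exact: num_real.
move=> k /ltW Mk; apply: nearW => n.
have := @covariance_error R m n pi1 pi2 (ltnW hm) => /le_trans; apply.
by rewrite [`|_ ^+ _|]ger0_norm ?exprn_ge0 // ler_wpM2r ?exprn_ge0.
Qed.
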